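(* Let $k\ge 2$ and, for $x=(X,Y)\in\mathbb{H}^k\oplus\mathbb{H}^k\cong\mathbb{R}^{8k}$, let $$G(x)=|X|^2|Y|^2-|\langle X,Y\rangle_H|^2 .$$ (i) The positive semidefinite polynomial $G$ is not a sum of squares of real polynomials. (ii) The polynomial $(|X|^2+|Y|^2)\,G(x)$ is a sum of squares of real polynomials, with the concrete representation $4(|X|^2+|Y|^2)\,G(x)=|\nabla G(x)|^2$. (iii) The following generalized Lagrange identity holds for all $x=(X,Y)\in\mathbb{H}^k\oplus\mathbb{H}^k$: $$4\Big(\sum_{\alpha=0}^4\langle P_\alpha x,x\rangle^2\Big)\Big(|X|^2|Y|^2-|\langle X,Y\rangle_H|^2\Big)=\Big|\Big(\sum_{\alpha=0}^4\langle P_\alpha x,x\rangle P_\alpha x\Big)\wedge x\Big|^2 .$$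
   Context: $\mathbb{H}$ denotes the quaternions with imaginary units $\mathbf{i},\mathbf{j},\mathbf{k}$; $\langle X,Y\rangle_H=\sum_{i=1}^kX_i\overline{Y_i}\in\mathbb{H}$ for $X=(X_1,\dots,X_k)$, $Y=(Y_1,\dots,Y_k)\in\mathbb{H}^k$; $\langle\cdot,\cdot\rangle$ is the real Euclidean inner product on $\mathbb{R}^{8k}$, $\nabla$ the Euclidean gradient on $\mathbb{R}^{8k}$. The real-linear maps $P_0,\dots,P_4$ on $\mathbb{H}^k\oplus\mathbb{H}^k$ are $$P_0x=(X,-Y),\quad P_1x=(Y,X),\quad P_2x=(\mathbf{i}Y,-\mathbf{i}X),\quad P_3x=(\mathbf{j}Y,-\mathbf{j}X),\quad P_4x=(\mathbf{k}Y,-\mathbf{k}X),$$ where $\mathbf{i}X=(\mathbf{i}X_1,\dots,\mathbf{i}X_k)$, etc. (left multiplication). For $v,w\in\mathbb{R}^{8k}$, $v\wedge w\in\Lambda^2(\mathbb{R}^{8k})$ carries the standard norm, $|v\wedge w|^2=|v|^2|w|^2-\langle v,w\rangle^2$. *)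

(* Defs.v *)
From HB Require Import structures.
From mathcomp Require Import all_boot all_order all_algebra ring.
From mathcomp Require Import reals normedtype derive.
(* The notations of mpoly clash with those of MathComp-Analysis: the polynomial
   ring {mpoly R[n]} is written mpoly n R below. *)
From mathcomp Require Import -(notations) mpoly.
Import Order.TTheory GRing.Theory Num.Theory numFieldNormedType.Exports.

Set Implicit Arguments.
Unset Strict Implicit.
Unset Printing Implicit Defensive.

Local Open Scope ring_scope.

(* Quaternions a + b i + c j + d k with coefficients in an arbitrary commutative
   ring A: the formula for G is used both for A = R (the function on R^8k) and
   for A = R[x_1, ..., x_8k] (the polynomial). *)
Record quat (A : Type) := Quat { q1 : A; qi : A; qj : A; qk : A }.

Section QuatRing.
Variable A : comNzRingType.
Implicit Types p q r : quat A.

Definition quat_tuple p := (q1 p, qi p, qj p, qk p).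
Definition tuple_quat (t : A * A * A * A) :=
  let: (a, b, c, d) := t in Quat a b c d.
Lemma quat_tupleK : cancel quat_tuple tuple_quat. Proof. by case. Qed.

HB.instance Definition _ := Choice.copy (quat A) (can_type quat_tupleK).

Definition addq p q :=
  Quat (q1 p + q1 q) (qi p + qi q) (qj p + qj q) (qk p + qk q).
Definition oppq p := Quat (- q1 p) (- qi p) (- qj p) (- qk p).
Definition mulq p q := Quat
  (q1 p * q1 q - qi p * qi q - qj p * qj q - qk p * qk q)
  (q1 p * qi q + qi p * q1 q + qj p * qk q - qk p * qj q)
  (q1 p * qj q - qi p * qk q + qj p * q1 q + qk p * qi q)
  (q1 p * qk q + qi p * qj q - qj p * qi q + qk p * q1 q).

Lemma addqA : associative addq.
Proof. by move=> [????] [????] [????]; congr Quat; rewrite /= addrA. Qed.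
Lemma addqC : commutative addq.
Proof. by move=> [????] [????]; congr Quat; rewrite /= addrC. Qed.
Lemma add0q : left_id (Quat 0 0 0 0) addq.
Proof. by move=> [????]; congr Quat; rewrite /= add0r. Qed.
Lemma addNq : left_inverse (Quat 0 0 0 0) oppq addq.
Proof. by move=> [????]; congr Quat; rewrite /= addNr. Qed.

HB.instance Definition _ := GRing.isZmodule.Build (quat A) addqA addqC add0q addNq.

Lemma mulqA : associative mulq.
Proof. by move=> [????] [????] [????]; congr Quat => /=; ring. Qed.
Lemma mul1q : left_id (Quat 1 0 0 0) mulq.
Proof. by move=> [????]; congr Quat => /=; ring. Qed.
Lemma mulq1 : right_id (Quat 1 0 0 0) mulq.
Proof. by move=> [????]; congr Quat => /=; ring. Qed.
Lemma mulqDl : left_distributive mulq addq.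
Proof. by move=> [????] [????] [????]; congr Quat => /=; ring. Qed.
Lemma mulqDr : right_distributive mulq addq.
Proof. by move=> [????] [????] [????]; congr Quat => /=; ring. Qed.
Lemma oneq_neq0 : Quat 1 0 0 0 != 0 :> quat A.
Proof. by apply/eqP => -[] /eqP; rewrite oner_eq0. Qed.

HB.instance Definition _ := GRing.Zmodule_isNzRing.Build (quat A)
  mulqA mul1q mulq1 mulqDl mulqDr oneq_neq0.

End QuatRing.

Section Quaternionic.
Variables (A : comNzRingType) (k : nat).

Definition ii : quat A := Quat 0 1 0 0.
Definition jj : quat A := Quat 0 0 1 0.
Definition kk : quat A := Quat 0 0 0 1.

Definition conjq (q : quat A) : quat A := Quat (q1 q) (- qi q) (- qj q) (- qk q).
Definition normq2 (q : quat A) : A :=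
  q1 q ^+ 2 + qi q ^+ 2 + qj q ^+ 2 + qk q ^+ 2.

Definition dotH (X Y : 'rV[quat A]_k) : quat A :=
  \sum_(i < k) X 0 i * conjq (Y 0 i).
Definition normH2 (X : 'rV[quat A]_k) : A := \sum_(i < k) normq2 (X 0 i).

Definition HH : Type := 'rV[quat A]_k * 'rV[quat A]_k.

(* The scaling *: of row vectors over the noncommutative ring quat A is left
   multiplication of the entries. *)
Definition P (alpha : 'I_5) (x : HH) : HH :=
  let: (X, Y) := x in
  match val alpha with
  | 0 => (X, - Y)
  | 1 => (Y, X)
  | 2 => (ii *: Y, - (ii *: X))
  | 3 => (jj *: Y, - (jj *: X))
  | _ => (kk *: Y, - (kk *: X))
  end.

Definition G (x : HH) : A := normH2 x.1 * normH2 x.2 - normq2 (dotH x.1 x.2).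

(* The identification of H^k (+) H^k with A^(8k). *)
Definition qcoord (q : quat A) (a : 'I_4) : A :=
  match val a with 0 => q1 q | 1 => qi q | 2 => qj q | _ => qk q end.
Definition flatH (X : 'rV[quat A]_k) : 'rV[A]_(k * 4) :=
  mxvec (\matrix_(i < k, a < 4) qcoord (X 0 i) a).
Definition unflatH (v : 'rV[A]_(k * 4)) : 'rV[quat A]_k :=
  \row_i let u := vec_mx v i in Quat (u 0) (u 1) (u 2%:R) (u 3%:R).

Definition flat (x : HH) : 'rV[A]_(k * 4 + k * 4) :=
  row_mx (flatH x.1) (flatH x.2).
Definition unflat (v : 'rV[A]_(k * 4 + k * 4)) : HH :=
  (unflatH (lsubmx v), unflatH (rsubmx v)).

Lemma flatHK : cancel flatH unflatH.
Proof.
move=> X; apply/rowP => i; rewrite mxE /flatH mxvecK !mxE.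
by case: (X 0 i).
Qed.

Lemma unflatHK : cancel unflatH flatH.
Proof.
move=> v; rewrite -[RHS]vec_mxK; congr mxvec; apply/matrixP => i a.
rewrite 2!mxE /qcoord /=.
by case: a => [[|[|[|[|//]]]] lta] /=; congr (vec_mx v i _); apply/val_inj.
Qed.

Lemma flatK : cancel flat unflat.
Proof. by case=> X Y; rewrite /unflat row_mxKl row_mxKr !flatHK. Qed.

Lemma unflatK : cancel unflat flat.
Proof. by move=> v; rewrite /flat !unflatHK hsubmxK. Qed.

End Quaternionic.

Section Euclidean.
Variables (A : comNzRingType) (n : nat).
Implicit Types u v w : 'rV[A]_n.

Definition dot v w : A := \sum_i v 0 i * w 0 i.
Definition norm2 v : A := dot v v.

(* An element of Lambda^2(A^n) is given by its coordinates on the basis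
   e_i /\ e_j with i < j, arranged in a skew-symmetric matrix; the standard norm
   makes this basis orthonormal. *)
Definition wedge v w : 'M[A]_n := \matrix_(i, j) (v 0 i * w 0 j - v 0 j * w 0 i).
Definition normL2 (M : 'M[A]_n) : A := \sum_(i < n) \sum_(j < n | (i < j)%N) M i j ^+ 2.

End Euclidean.

Section Sanity.

Lemma norm2_flat (A : comNzRingType) k (x : HH A k) :
  norm2 (flat x) = normH2 x.1 + normH2 x.2.
Proof.
have flatH2 (X : 'rV[quat A]_k) : norm2 (flatH X) = normH2 X.
  rewrite /norm2 /dot (reindex _ (curry_mxvec_bij _ _)) /=.
  have -> : normH2 X = \sum_i \sum_a flatH X 0 (mxvec_index i a) ^+ 2.
    apply: eq_bigr => i _; under eq_bigr do rewrite mxvecE mxE.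
    by rewrite !big_ord_recl big_ord0 /= /qcoord /normq2 /=; ring.
  by rewrite pair_bigA /=; apply: eq_bigr => -[i a] _; rewrite expr2.
rewrite -!flatH2 /norm2 /dot big_split_ord /=; congr (_ + _).
  by apply: eq_bigr => i _; rewrite !row_mxEl.
by apply: eq_bigr => i _; rewrite !row_mxEr.
Qed.

Lemma normL2_wedge (R : realType) n (v w : 'rV[R]_n) :
  normL2 (wedge v w) = norm2 v * norm2 w - dot v w ^+ 2.
Proof.
pose F i j := (v 0 i * w 0 j - v 0 j * w 0 i) ^+ 2.
have symF i j : F i j = F j i by rewrite /F; ring.
have F0 i : F i i = 0 by rewrite /F subrr expr0n.
have LE : normL2 (wedge v w) = \sum_(i < n) \sum_(j < n | (i < j)%N) F i j.
  by rewrite /normL2; do 2!apply: eq_bigr => ? _; rewrite mxE.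
have GE : normL2 (wedge v w) = \sum_(i < n) \sum_(j < n | (j < i)%N) F i j.
  rewrite LE (exchange_big_dep predT) //=; apply: eq_bigr => i _.
  by apply: eq_bigr => j _; rewrite symF.
have tot : \sum_i \sum_j F i j = 2 * normL2 (wedge v w).
  rewrite mulr_natl mulr2n {1}LE GE -big_split /=; apply: eq_bigr => i _.
  rewrite (bigID (fun j : 'I_n => (i < j)%N)) /=; congr (_ + _).
  rewrite (bigD1 i) ?ltnn //= F0 add0r; apply: eq_bigl => j.
  by rewrite -leqNgt ltn_neqAle andbC.
have : \sum_i \sum_j F i j = 2 * (norm2 v * norm2 w - dot v w ^+ 2).
  rewrite /norm2 /dot expr2 !big_distrlr /= -sumrB mulr_sumr.
  have -> : \sum_i \sum_j F i j = \sum_i \sum_j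
      (v 0 i * v 0 i * (w 0 j * w 0 j) + v 0 j * v 0 j * (w 0 i * w 0 i) -
       2 * (v 0 i * w 0 i * (v 0 j * w 0 j))).
    by do 2!apply: eq_bigr => ? _; rewrite /F; ring.
  under eq_bigr do rewrite sumrB big_split /=.
  rewrite sumrB big_split /= [X in _ + X - _]exchange_big /=.
  under [X in _ = X]eq_bigr do rewrite mulrBr mulr_sumr mulr_sumr.
  rewrite sumrB; congr (_ - _).
  rewrite -big_split /=; apply: eq_bigr => i _; rewrite -big_split /=.
  by apply: eq_bigr => j _; ring.
by rewrite tot => /mulfI; apply; rewrite pnatr_eq0.
Qed.

Lemma rmorph_G (A B : comNzRingType) (f : {rmorphism A -> B}) k
    (v : 'rV[A]_(k * 4 + k * 4)) :
  f (G (unflat v)) = G (unflat (map_mx f v)).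
Proof.
pose fq (q : quat A) := Quat (f (q1 q)) (f (qi q)) (f (qj q)) (f (qk q)).
have fqD : {morph fq : p q / p + q}.
  by move=> p q; congr Quat; rewrite /= rmorphD.
have fq0 : fq 0 = 0 by congr Quat; rewrite /= rmorph0.
have fqM : {morph fq : p q / p * q}.
  by move=> p q; congr Quat; rewrite /= ?(rmorphD, rmorphB, rmorphM, rmorphN).
have fqC q : fq (conjq q) = conjq (fq q).
  by congr Quat; rewrite /= ?rmorphN.
have fN q : f (normq2 q) = normq2 (fq q).
  by rewrite /normq2 !rmorphD !rmorphXn.
have fU (w : 'rV[A]_(k * 4)) i : fq (unflatH w 0 i) = unflatH (map_mx f w) 0 i.
  by rewrite !mxE; congr Quat; rewrite /= !mxE.
have fH (w : 'rV[A]_(k * 4)) : f (normH2 (unflatH w)) =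
    normH2 (unflatH (map_mx f w)).
  by rewrite rmorph_sum; apply: eq_bigr => i _; rewrite fN fU.
rewrite /G /unflat /= rmorphB rmorphM !fH fN map_lsubmx map_rsubmx.
congr (_ - normq2 _); rewrite /dotH (big_morph fq fqD fq0).
by apply: eq_bigr => i _; rewrite fqM fqC !fU map_lsubmx map_rsubmx.
Qed.

End Sanity.

Section RealPolynomials.
Variables (R : realType) (n : nat).

Definition psd (p : mpoly n R) : Prop := forall v : 'I_n -> R, 0 <= meval v p.

Definition sos (p : mpoly n R) : Prop :=
  exists s : seq (mpoly n R), p = \sum_(q <- s) q ^+ 2.

Definition generic_point : 'rV[mpoly n R]_n := \row_i mpolyX R (mnm1 i).

Definition grad (f : 'rV[R]_n -> R) (v : 'rV[R]_n) : 'rV[R]_n :=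
  \row_i 'D_(delta_mx 0 i) f v.

End RealPolynomials.

Definition Gfun (R : realType) (k : nat) (v : 'rV[R]_(k * 4 + k * 4)) : R :=
  G (unflat v).
Definition Gpoly (R : realType) (k : nat) : mpoly (k * 4 + k * 4) R :=
  G (unflat (generic_point R _)).
Definition sqnorm_poly (R : realType) (k : nat) : mpoly (k * 4 + k * 4) R :=
  let x := unflat (generic_point R (k * 4 + k * 4)) in normH2 x.1 + normH2 x.2.

Lemma meval_Gpoly (R : realType) k (v : 'rV[R]_(k * 4 + k * 4)) :
  meval (v 0) (Gpoly R k) = Gfun v.
Proof.
rewrite /Gpoly rmorph_G /Gfun; congr (G (unflat _)).
by apply/rowP => i; rewrite !mxE; exact: mevalXU.
Qed.

(* Main.v *)
(* Writing c_alpha = <P_alpha x, x>, one has 4 G = |x|^4 - sum c_alpha^2, so that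
   grad G = |x|^2 x - sum c_alpha P_alpha x. The vectors P_alpha x are orthogonal
   of norm |x|, which gives |grad G|^2 = 4 |x|^2 G over any commutative ring; this
   yields (ii), (iii) and G >= 0.
   If G were a sum of squares of polynomials q, then each q would be affine along
   every line in X or in Y, as G is quadratic there, and q would vanish where G
   does. Hence q is biadditive and q(X, aX) = 0 for every quaternion a, that is,
   q is skew and q(X, aY) = q(aX, Y) for all a; comparing ij = k with ji = -k
   forces q = 0. But G(e_0, e_1) = 1. *)

Require Import Defs.
From HB Require Import structures.
From mathcomp Require Import all_boot all_order all_algebra ring lra.
From mathcomp Require Import boolp classical_sets reals topology normedtype derive.
From mathcomp Require Import -(notations) mpoly.
Import Order.TTheory GRing.Theory Num.Theory numFieldNormedType.Exports.

Set Implicit Arguments.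
Unset Strict Implicit.
Unset Printing Implicit Defensive.

Local Open Scope classical_set_scope.
Local Open Scope ring_scope.

(** * Conjugation and the quaternionic Hermitian form *)

Lemma quat_eq (A : Type) (p q : quat A) :
  q1 p = q1 q -> qi p = qi q -> qj p = qj q -> qk p = qk q -> p = q.
Proof. by case: p q => [? ? ? ?] [? ? ? ?] /= -> -> -> ->. Qed.

Lemma conjqD (A : comNzRingType) : {morph @conjq A : p q / p + q}.
Proof. by move=> p q; congr Quat; rewrite /= opprD. Qed.

Lemma conjq0 (A : comNzRingType) : conjq (0 : quat A) = 0.
Proof. by congr Quat; rewrite /= oppr0. Qed.

Lemma conjqN (A : comNzRingType) : {morph @conjq A : p / - p}.
Proof. by []. Qed.

Lemma conjqM (A : comNzRingType) (p q : quat A) :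
  conjq (p * q) = conjq q * conjq p.
Proof. by apply: quat_eq => /=; ring. Qed.

Lemma conjqK (A : comNzRingType) : involutive (@conjq A).
Proof. by move=> p; apply: quat_eq; rewrite /= ?opprK. Qed.

Lemma dotHDl (A : comNzRingType) k (X X' Y : 'rV[quat A]_k) :
  dotH (X + X') Y = dotH X Y + dotH X' Y.
Proof. by rewrite -big_split; apply: eq_bigr => i _; rewrite mxE mulrDl. Qed.

Lemma dotHZl (A : comNzRingType) k q (X Y : 'rV[quat A]_k) :
  dotH (q *: X) Y = q * dotH X Y.
Proof. by rewrite mulr_sumr; apply: eq_bigr => i _; rewrite mxE mulrA. Qed.

Lemma dotHC (A : comNzRingType) k (X Y : 'rV[quat A]_k) :
  dotH Y X = conjq (dotH X Y).
Proof.
rewrite /dotH (big_morph _ (@conjqD A) (conjq0 A)).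
by apply: eq_bigr => i _; rewrite conjqM conjqK.
Qed.

Lemma dotHNl (A : comNzRingType) k (X Y : 'rV[quat A]_k) :
  dotH (- X) Y = - dotH X Y.
Proof. by rewrite -scaleN1r dotHZl mulN1r. Qed.

Lemma dotHDr (A : comNzRingType) k (X Y Y' : 'rV[quat A]_k) :
  dotH X (Y + Y') = dotH X Y + dotH X Y'.
Proof. by rewrite dotHC dotHDl conjqD -!dotHC. Qed.

Lemma dotHNr (A : comNzRingType) k (X Y : 'rV[quat A]_k) :
  dotH X (- Y) = - dotH X Y.
Proof. by rewrite dotHC dotHNl conjqN -dotHC. Qed.

Lemma dotHZr (A : comNzRingType) k q (X Y : 'rV[quat A]_k) :
  dotH X (q *: Y) = dotH X Y * conjq q.
Proof. by rewrite dotHC dotHZl conjqM -dotHC. Qed.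

Lemma dotHH (A : comNzRingType) k (X : 'rV[quat A]_k) :
  dotH X X = Quat (normH2 X) 0 0 0.
Proof.
pose r (a : A) := Quat a 0 0 0.
have rD : {morph r : a b / a + b}.
  by move=> a b; apply: quat_eq; rewrite //= addr0.
rewrite -[RHS]/(r _) (big_morph r rD (erefl _)).
by apply: eq_bigr => i _; apply: quat_eq; rewrite /= /normq2; ring.
Qed.

(** * The Euclidean inner product in coordinates *)

Lemma dotDl (A : comNzRingType) n (u v w : 'rV[A]_n) :
  dot (u + v) w = dot u w + dot v w.
Proof. by rewrite -big_split; apply: eq_bigr => i _; rewrite mxE mulrDl. Qed.

Lemma dotZl (A : comNzRingType) n a (u w : 'rV[A]_n) :
  dot (a *: u) w = a * dot u w.
Proof. by rewrite mulr_sumr; apply: eq_bigr => i _; rewrite mxE mulrA. Qed.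

Lemma dotC (A : comNzRingType) n (u w : 'rV[A]_n) : dot u w = dot w u.
Proof. by apply: eq_bigr => i _; rewrite mulrC. Qed.

Lemma dotDr (A : comNzRingType) n (u v w : 'rV[A]_n) :
  dot u (v + w) = dot u v + dot u w.
Proof. by rewrite !(dotC u) dotDl. Qed.

Lemma dotZr (A : comNzRingType) n a (u w : 'rV[A]_n) :
  dot u (a *: w) = a * dot u w.
Proof. by rewrite !(dotC u) dotZl. Qed.

(** Turns Euclidean products into real parts of [dotH], whose sesquilinearity then handles the maps
    [P]. *)
Lemma dot_flat (A : comNzRingType) k (x y : HH A k) :
  dot (flat x) (flat y) = q1 (dotH x.1 y.1) + q1 (dotH x.2 y.2).
Proof.
have q1D : {morph @q1 A : p q / p + q} by [].
have flatH2 (X Y : 'rV[quat A]_k) : dot (flatH X) (flatH Y) = q1 (dotH X Y).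
  rewrite /dot (reindex _ (curry_mxvec_bij _ _)) /=.
  have -> : q1 (dotH X Y) = \sum_i \sum_a
      flatH X 0 (mxvec_index i a) * flatH Y 0 (mxvec_index i a).
    rewrite /dotH (big_morph _ q1D (erefl _)).
    apply: eq_bigr => i _; under eq_bigr do rewrite !mxvecE !mxE.
    by rewrite !big_ord_recl big_ord0 /= /qcoord /=; ring.
  by rewrite pair_bigA /=; apply: eq_bigr => -[i a] _.
rewrite -!flatH2 /dot big_split_ord /=; congr (_ + _).
  by apply: eq_bigr => i _; rewrite !row_mxEl.
by apply: eq_bigr => i _; rewrite !row_mxEr.
Qed.

(** * Norm identities for the Clifford system [P] *)

Definition Pform (A : comNzRingType) k (alpha : 'I_5) (x : HH A k) : A :=
  dot (flat (P alpha x)) (flat x).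

Definition Pfield (A : comNzRingType) k (x : HH A k) :=
  \sum_(alpha < 5) Pform alpha x *: flat (P alpha x).

(** The gradient of [G], written algebraically so that it also makes sense over a polynomial ring.
    The scalar -1 lets [dot] be expanded through sums and scalings alone. *)
Definition Gfield (A : comNzRingType) k (x : HH A k) :=
  norm2 (flat x) *: flat x + (-1) *: Pfield x.

Definition dotHE := (dotHDl, dotHNl, dotHZl, dotHDr, dotHNr, dotHZr).

Lemma dot_suml (A : comNzRingType) n (I : finType) (u : I -> 'rV[A]_n) w :
  dot (\sum_i u i) w = \sum_i dot (u i) w.
Proof.
rewrite /dot exchange_big; apply: eq_bigr => j _.
by rewrite summxE mulr_suml.
Qed.

(** The summand is a function on [nat], so that the [nth] tables below compute at numerals. *)
Lemma big_ord5 (V : nmodType) (F : nat -> V) :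
  \sum_(i < 5) F i = F 0%N + (F 1%N + (F 2%N + (F 3%N + F 4%N))).
Proof. by rewrite 5!big_ord_recl big_ord0 addr0. Qed.

(** [S] is the derivative of [dotH X Y] in the direction [(Z, W)]; left multiplication by an
    imaginary unit picks out the matching coordinate of [S]. *)
Lemma dot_flatP (A : comNzRingType) k (X Y Z W : 'rV[quat A]_k) (alpha : 'I_5) :
  let S := dotH Z Y + dotH X W in
  dot (flat (P alpha (X, Y))) (flat (Z, W)) =
  nth 0 [:: q1 (dotH X Z) - q1 (dotH Y W); q1 S; qi S; qj S; qk S] alpha.
Proof.
rewrite dot_flat.
case: alpha => -[|[|[|[|[|//]]]]] lta; rewrite /= ?dotHE ?(dotHC Z Y) /=; ring.
Qed.

Lemma Pform_nth (A : comNzRingType) k (X Y : 'rV[quat A]_k) (alpha : 'I_5) :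
  let D := dotH X Y in
  Pform alpha (X, Y) =
  nth 0 [:: normH2 X - normH2 Y; 2 * q1 D; 2 * qi D; 2 * qj D; 2 * qk D] alpha.
Proof.
rewrite /Pform dot_flatP !dotHH.
by case: alpha => -[|[|[|[|[|//]]]]] lta /=; ring.
Qed.

(** These are the relations of a Clifford system evaluated at [x]; each of the 25 cases is an
    identity in the coordinates of [dotH X Y] and the two norms. *)
Lemma dot_P (A : comNzRingType) k (x : HH A k) (alpha beta : 'I_5) :
  dot (flat (P alpha x)) (flat (P beta x)) = norm2 (flat x) *+ (alpha == beta).
Proof.
case: x => X Y; rewrite norm2_flat dot_flat.
case: alpha beta => -[|[|[|[|[|//]]]]] lta [[|[|[|[|[|//]]]]] ltb];
  rewrite -val_eqE /= ?dotHE ?dotHH ?(dotHC X Y) /=;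
  case: (dotH X Y) => a b c d /=; ring.
Qed.

(** From (a + b)^2 - (a - b)^2 = 4ab with a = |X|^2 and b = |Y|^2; the last four forms contribute 4
    [normq2 (dotH X Y)]. *)
Lemma sum_Pform2 (A : comNzRingType) k (x : HH A k) :
  \sum_(alpha < 5) Pform alpha x ^+ 2 = norm2 (flat x) ^+ 2 - 4 * G x.
Proof.
case: x => X Y; under eq_bigr do rewrite Pform_nth.
rewrite (big_ord5 (fun i => nth 0 _ i ^+ 2)) norm2_flat /G /normq2 /=.
by ring.
Qed.

Lemma dot_Pfield (A : comNzRingType) k (x : HH A k) :
  dot (Pfield x) (flat x) = \sum_(alpha < 5) Pform alpha x ^+ 2.
Proof. by rewrite dot_suml; apply: eq_bigr => alpha _; rewrite dotZl expr2. Qed.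

Lemma norm2_Pfield (A : comNzRingType) k (x : HH A k) :
  norm2 (Pfield x) = norm2 (flat x) * \sum_(alpha < 5) Pform alpha x ^+ 2.
Proof.
rewrite {1}/norm2 dot_suml mulr_sumr; apply: eq_bigr => alpha _.
rewrite dotZl dotC dot_suml (bigD1 alpha) //= big1 => [|beta /negPf ne].
  by rewrite dotZl dot_P eqxx mulr1n; ring.
by rewrite dotZl dot_P ne mulr0.
Qed.

(** With N = |x|^2 and S the sum of the squared forms, the left side is N^3 - 2NS + NS = N(N^2 - S),
    and N^2 - S = 4G. *)
Lemma norm2_Gfield (A : comNzRingType) k (x : HH A k) :
  norm2 (Gfield x) = 4 * norm2 (flat x) * G x.
Proof.
rewrite /Gfield {1}/norm2 !(dotDl, dotDr, dotZl, dotZr) (dotC (flat x)).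
rewrite -!/(norm2 _) norm2_Pfield dot_Pfield sum_Pform2; ring.
Qed.

(** * Expansion of [G] along lines, its gradient and its sign *)

(** The Horner form of the argument is the one that [dotH_line] produces. *)
Lemma normq2_line (A : comNzRingType) (t : A) (p0 p1 p2 : quat A) :
  normq2 (p0 + Quat t 0 0 0 * (p1 + Quat t 0 0 0 * p2)) =
  normq2 p0 + t * (2 * q1 (p0 * conjq p1))
  + t ^+ 2 * (normq2 p1 + 2 * q1 (p0 * conjq p2))
  + t ^+ 3 * (2 * q1 (p1 * conjq p2)) + t ^+ 4 * normq2 p2.
Proof. by rewrite /normq2 /=; ring. Qed.

Lemma normH2E (A : comNzRingType) k (X : 'rV[quat A]_k) :
  normH2 X = q1 (dotH X X).
Proof. by rewrite dotHH. Qed.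

Lemma normH2_line (A : comNzRingType) k (t : A) (X Z : 'rV[quat A]_k) :
  normH2 (X + Quat t 0 0 0 *: Z) =
  normH2 X + t * (2 * q1 (dotH X Z)) + t ^+ 2 * normH2 Z.
Proof.
rewrite [LHS]normH2E !dotHE !dotHH (dotHC X Z) /=; ring.
Qed.

Lemma dotH_line (A : comNzRingType) k (t : A) (X Y Z W : 'rV[quat A]_k) :
  dotH (X + Quat t 0 0 0 *: Z) (Y + Quat t 0 0 0 *: W) =
  dotH X Y + Quat t 0 0 0 * (dotH Z Y + dotH X W + Quat t 0 0 0 * dotH Z W).
Proof. rewrite !dotHE; apply: quat_eq => /=; ring. Qed.

(** The right side is the formal derivative of [G] by the Leibniz rule, which identifies [Gfield] as
    the gradient over any [A]. *)
Lemma dot_Gfield (A : comNzRingType) k (X Y Z W : 'rV[quat A]_k) :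
  dot (Gfield (X, Y)) (flat (Z, W)) =
  2 * normH2 Y * q1 (dotH X Z) + 2 * normH2 X * q1 (dotH Y W)
  - 2 * q1 (dotH X Y * conjq (dotH Z Y + dotH X W)).
Proof.
rewrite dotDl !dotZl dot_suml; under eq_bigr do rewrite dotZl Pform_nth dot_flatP.
rewrite (big_ord5 (fun i => nth 0 _ i * nth 0 _ i)) norm2_flat dot_flat /=.
by case: (dotH X Y) => a b c d /=; ring.
Qed.

(* Row vectors over quat A carry no A-module structure: a scalar t acts as the
   real quaternion Quat t 0 0 0. *)
Lemma G_line (A : comNzRingType) k (x z : HH A k) : {c : A * A |
  forall t, G (x.1 + Quat t 0 0 0 *: z.1, x.2 + Quat t 0 0 0 *: z.2) =
  G x + t * dot (Gfield x) (flat z)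
  + t ^+ 2 * c.1 + t ^+ 3 * c.2 + t ^+ 4 * G z}.
Proof.
case: x z => X Y [Z W].
exists (normH2 X * normH2 W + normH2 Z * normH2 Y
        + 4 * q1 (dotH X Z) * q1 (dotH Y W)
        - normq2 (dotH Z Y + dotH X W) - 2 * q1 (dotH X Y * conjq (dotH Z W)),
        2 * normH2 W * q1 (dotH X Z) + 2 * normH2 Z * q1 (dotH Y W)
        - 2 * q1 ((dotH Z Y + dotH X W) * conjq (dotH Z W))) => t.
rewrite dot_Gfield /G /= !normH2_line dotH_line normq2_line.
by rewrite /normq2 /=; ring.
Qed.

Lemma flat_line (A : comNzRingType) k (t : A) (x z : HH A k) :
  flat (x.1 + Quat t 0 0 0 *: z.1, x.2 + Quat t 0 0 0 *: z.2) =
  flat x + t *: flat z.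
Proof.
have flatH_line (X Z : 'rV[quat A]_k) :
    flatH (X + Quat t 0 0 0 *: Z) = flatH X + t *: flatH Z.
  rewrite /flatH -linearZ -linearD; congr mxvec; apply/matrixP => i a.
  rewrite !mxE /qcoord; case: (val a) => [|[|[|?]]] /=; ring.
by rewrite /flat /= !flatH_line scale_row_mx add_row_mx.
Qed.

(** By [G_line] the difference quotient is a polynomial in t away from 0, and the derivative is its
    constant term. *)
Lemma derive_Gfun (R : realType) k (v w : 'rV[R]_(k * 4 + k * 4)) :
  'D_w (@Gfun R k) v = dot (Gfield (unflat v)) w.
Proof.
have [c Gc] := G_line (unflat v) (unflat w).
set x := unflat v in Gc *; set z := unflat w in Gc.
have GE t : Gfun (t *: w + v) = G x + t * dot (Gfield x) w
    + t ^+ 2 * c.1 + t ^+ 3 * c.2 + t ^+ 4 * G z.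
  by rewrite /Gfun -{1}[v]unflatK -[w]unflatK addrC -flat_line flatK Gc.
apply: cvg_lim => //.
have cvg0 : (fun t => dot (Gfield x) w + t * (c.1 + t * c.2 + t * t * G z))
    @ 0^' --> dot (Gfield x) w + 0 * (c.1 + 0 * c.2 + 0 * 0 * G z).
  apply: cvg_within_filter.
  apply: cvgD; first exact: cvg_cst.
  apply: cvgM; first exact: cvg_id.
  apply: cvgD; first (apply: cvgD; first exact: cvg_cst).
    by apply: cvgM; [exact: cvg_id | exact: cvg_cst].
  by apply: cvgM; [apply: cvgM; exact: cvg_id | exact: cvg_cst].
rewrite mul0r addr0 in cvg0; apply: cvg_trans cvg0; apply: near_eq_cvg.
(* The limit is over a deleted neighbourhood of 0, so division by t is allowed. *)
near=> t; have t0 : t != 0 by near: t; exact: nbhs_dnbhs_neq.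
by rewrite /shift /= GE /Gfun -/x [in RHS]/GRing.scale /=; field.
Unshelve. all: by end_near.
Qed.

Lemma norm2_grad_Gfun (R : realType) k (v : 'rV[R]_(k * 4 + k * 4)) :
  norm2 (grad (@Gfun R k) v) = 4 * norm2 v * Gfun v.
Proof.
have -> : grad (@Gfun R k) v = Gfield (unflat v).
  apply/rowP => i; rewrite mxE derive_Gfun /dot (bigD1 i) //= big1 => [|j ji].
    by rewrite [delta_mx _ _ _ _]mxE !eqxx mulr1 addr0.
  by rewrite [delta_mx _ _ _ _]mxE (negPf ji) andbF mulr0.
by rewrite norm2_Gfield unflatK.
Qed.

(** [norm2_Gfield] makes 4|x|^2 G a sum of squares of numbers, which settles the sign of [G] unless
    |x|^2 = 0. *)
Lemma G_ge0 (R : realDomainType) k (x : HH R k) : 0 <= G x.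
Proof.
have norm2_ge0 (v : 'rV[R]_(k * 4 + k * 4)) : 0 <= norm2 v.
  by apply: sumr_ge0 => i _; rewrite -expr2 sqr_ge0.
have [x0|x_neq0] := eqVneq (norm2 (flat x)) 0.
  have flat0 : flat x = 0.
    apply/rowP => i; rewrite [RHS]mxE; apply/eqP; rewrite -sqrf_eq0 expr2.
    by apply/eqP/(psumr_eq0P _ x0) => // j _; rewrite -expr2 sqr_ge0.
  (* At x = 0 the other terms of [sum_Pform2] vanish, leaving 4 [G x] = 0. *)
  have := sum_Pform2 x; rewrite -dot_Pfield dotC flat0.
  rewrite (_ : dot 0 (Pfield x) = 0); last by rewrite -(scale0r 0) dotZl mul0r.
  rewrite -flat0 x0 expr0n sub0r => /eqP.
  by rewrite eq_sym oppr_eq0 mulf_eq0 pnatr_eq0 => /eqP ->.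
have := norm2_ge0 (Gfield x); rewrite norm2_Gfield pmulr_rge0 //.
by rewrite pmulr_rgt0 ?ltr0n // lt0r x_neq0 norm2_ge0.
Qed.

(** * Sums of squares of polynomials and their restriction to lines *)

(** [norm2_Gfield] is applied in the polynomial ring itself, at the generic point; halving the
    coordinates of [Gfield] absorbs the factor 4. *)
Lemma sos_sqnorm_Gpoly (R : realType) k : sos (sqnorm_poly R k * Gpoly R k).
Proof.
rewrite /sqnorm_poly /Gpoly; set x := unflat _.
have half2 : (2^-1 : R) ^+ 2 * 4 = 1 by field.
exists [seq 2^-1 *: Gfield x 0 i | i <- index_enum _].
rewrite big_map; under eq_bigr do rewrite exprZn expr2.
rewrite -scaler_sumr -[\sum_i _]/(norm2 _) norm2_Gfield norm2_flat -mulrA.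
by rewrite -mpolyC_nat mul_mpolyC scalerA half2 scale1r.
Qed.

(* The leading coefficients of squares cannot cancel in an ordered ring. *)
Lemma size_sos (R : realDomainType) m (s : seq {poly R}) :
  (size (\sum_(p <- s) p ^+ 2)%R <= m.*2.+1)%N ->
  forall p, p \in s -> (size p <= m.+1)%N.
Proof.
have coef_sqr N (p : {poly R}) : (size p <= N.+1)%N -> (p ^+ 2)`_N.*2 = p`_N ^+ 2.
  move=> szp; have N2 : (N < N.*2.+1)%N by rewrite ltnS -addnn leq_addr.
  rewrite {1}expr2 coefM (bigD1 (Ordinal N2)) //= big1 => [|[j ltj]].
    by rewrite addr0 -addnn addnK expr2.
  rewrite -val_eqE /= => jN; have [ltjN|leNj] := ltnP j N; last first.
    by rewrite nth_default ?mul0r // (leq_trans szp) // ltn_neqAle eq_sym jN.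
  rewrite mulrC nth_default ?mul0r // (leq_trans szp) //.
  by rewrite -addnn ltn_subRL addnC ltn_add2l.
(* Descending induction on the excess [N] of the sizes over m + 1: the step from N + 1 to N uses
   that the sum has no term of degree 2(m + N + 1). *)
move=> szS; suff bound N : (forall p, p \in s -> size p <= (m + N).+1)%N ->
    forall p, p \in s -> (size p <= m.+1)%N.
  apply: (bound (\max_(p <- s) size p)%N) => p ps.
  pose sz (q : {poly R}) := size q.
  apply: leq_trans (@leq_bigmax_seq _ _ xpredT sz p ps isT) _.
  by rewrite leqW ?leq_addl.
elim: N => [|N IHN] szs; first by rewrite addn0 in szs.
apply: IHN => p ps; rewrite -ltnS ltn_neqAle -addnS szs // andbT.
apply/eqP => szp.
have : (\sum_(p <- s) p ^+ 2)`_((m + N.+1).*2) == 0.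
  rewrite nth_default // (leq_trans szS) // addnS doubleS doubleD !ltnS.
  by rewrite leqW ?leq_addr.
rewrite coef_sum big_seq; under eq_bigr => q qs do rewrite coef_sqr ?szs //.
rewrite psumr_eq0 => [/allP /(_ p ps)|q _]; last exact: sqr_ge0.
rewrite ps sqrf_eq0 -[(m + N.+1)%N]/((m + N.+1).+1.-1) -szp -/(lead_coef p).
by rewrite lead_coef_eq0 -size_poly_eq0 szp.
Qed.

(** A nonzero difference would have as many distinct roots as its size: the integers 0, 1, ...,
    distinct in characteristic 0. *)
Lemma poly_ext (R : numDomainType) (p q : {poly R}) :
  (forall t, p.[t] = q.[t]) -> p = q.
Proof.
move=> pq; apply/eqP; rewrite -subr_eq0; apply/negPn/negP => nz.
have := max_poly_roots nz (rs := [seq i%:R | i <- iota 0 (size (p - q))]).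
rewrite size_map size_iota ltnn; case/(_ _ _)/negP => //.
  by apply/allP => _ /mapP[i _ ->]; rewrite /root !hornerE pq subrr.
by rewrite map_inj_uniq ?iota_uniq //; exact: mulrIn (oner_neq0 _).
Qed.

Lemma meval_line (R : comNzRingType) n (q : mpoly n R) (v w : 'rV[R]_n) :
  exists p : {poly R}, forall t, p.[t] = meval ((v + t *: w) 0) q.
Proof.
(* The variable of index i is replaced by the polynomial v_i + w_i X. *)
exists (mmap (@polyC R) (fun i => (v 0 i)%:P + w 0 i *: 'X) q) => t.
rewrite /meval /mmap horner_sum; apply: eq_bigr => m _.
rewrite hornerM hornerC; congr (_ * _); rewrite /mmap1 horner_prod.
by apply: eq_bigr => i _; rewrite horner_exp !hornerE !mxE mulrC.
Qed.

(** On the line the squares add up to a univariate polynomial of degree at most 2, so [size_sos]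
    with m = 1 bounds each degree by 1. *)
Lemma sos_affine_line (R : realType) n (s : seq (mpoly n R)) (v w : 'rV[R]_n)
    (a b c : R) :
  (forall t, \sum_(q <- s) meval ((v + t *: w) 0) q ^+ 2 =
             a + t * b + t ^+ 2 * c) ->
  forall q, q \in s ->
  exists e : R * R, forall t, meval ((v + t *: w) 0) q = e.1 + t * e.2.
Proof.
move=> quad q qs.
have [line lineE] := choice (fun q => meval_line q v w).
have szline : (size (line q) <= 2)%N.
  apply: (@size_sos _ 1 [seq line q | q <- s]); last exact: map_f.
  rewrite (_ : \sum_(p <- _) _ = \poly_(i < 3) nth 0 [:: a; b; c] i) ?size_poly //.
  apply: poly_ext => t; rewrite horner_poly !big_ord_recl big_ord0 /=.
  rewrite big_map horner_sum; under eq_bigr do rewrite horner_exp lineE.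
  by rewrite quad; ring.
exists ((line q)`_0, (line q)`_1) => t.
rewrite -lineE (horner_coef_wide _ szline) !big_ord_recl big_ord0 /=; ring.
Qed.

(** * Zeros of [G] and the obstruction to a sum of squares *)

Lemma G_sym (A : comNzRingType) k (X Y : 'rV[quat A]_k) : G (X, Y) = G (Y, X).
Proof. by rewrite /G /= (dotHC X Y) /normq2 /=; ring. Qed.

(** Moving one argument only keeps [G] quadratic in t, where [G_line] is quartic; this is the shape
    that [sos_affine_line] requires. *)
Lemma G_liner (A : comNzRingType) k (X Y Z : 'rV[quat A]_k) (t : A) :
  G (X, Y + Quat t 0 0 0 *: Z) =
  G (X, Y) + t * (2 * normH2 X * q1 (dotH Y Z)
                  - 2 * q1 (dotH X Y * conjq (dotH X Z))) + t ^+ 2 * G (X, Z).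
Proof.
by rewrite /G /= normH2_line !dotHE /normq2 /=; ring.
Qed.

(** Equality case of the Cauchy-Schwarz inequality: both terms of [G] equal |q|^2 |X|^4. *)
Lemma G_collinear (A : comNzRingType) k (q : quat A) (X : 'rV[quat A]_k) :
  G (X, q *: X) = 0.
Proof. by rewrite /G /= (normH2E (q *: X)) !dotHE dotHH /normq2 /=; ring. Qed.

Lemma affine_additive (R : realFieldType) k (f : 'rV[quat R]_k -> R) :
  f 0 = 0 ->
  (forall Y Z, exists e : R * R,
     forall t, f (Y + Quat t 0 0 0 *: Z) = e.1 + t * e.2) ->
  {morph f : Y Z / Y + Z}.
Proof.
move=> f0 f_aff Y Z.
have f_mid U V : 2 * f (U + V) = f (U + U) + f (V + V).
  (* This line meets 2U, U + V and 2V at t = 0, 1, 2, and an affine function has zero second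
     difference. Doubling the points avoids the scalar 1/2. *)
  have [e fE] := f_aff (U + U) (V - U).
  have r0 : Quat (0 : R) 0 0 0 = 0 by [].
  have r1 : Quat (1 : R) 0 0 0 = 1 by [].
  have r2 : Quat (2 : R) 0 0 0 = 1 + 1 by apply: quat_eq; rewrite //= addr0.
  move: (fE 0) (fE 1) (fE 2); rewrite r0 r1 r2 scalerDl scale0r !scale1r.
  rewrite addr0 (addrACA U U V) subrr addr0 (addrACA U U (V - U)) !subrKC; lra.
by have := f_mid Y Z; have := f_mid Y 0; have := f_mid Z 0; rewrite !addr0 f0; lra.
Qed.

Lemma biadditive_eq0 (R : numDomainType) k
    (f : 'rV[quat R]_k -> 'rV[quat R]_k -> R) :
  (forall X, {morph f X : Y Z / Y + Z}) ->
  (forall Y, {morph f^~ Y : X Z / X + Z}) ->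
  (forall q X, f X (q *: X) = 0) -> forall X Y, f X Y = 0.
Proof.
move=> fDr fDl f0 X Y.
(* Polarization of f(X, qX) = 0 at X = Z + W. *)
have skew q Z W : f Z (q *: W) = - f W (q *: Z).
  have /eqP := f0 q (Z + W).
  by rewrite scalerDr (fDl _ Z W) !fDr !f0 add0r addr0 addr_eq0 => /eqP.
have swap q Z W : f Z (q *: W) = f (q *: Z) W.
  by rewrite skew -[W in RHS]scale1r (skew 1) scale1r.
have fk W : f X (kk R *: W) = 0.
  have ijk : ii R * jj R = kk R by apply: quat_eq => /=; ring.
  have jik : jj R * ii R = - kk R by apply: quat_eq => /=; ring.
  (* Moving i and then j to the other argument reverses their order, so ij = k arrives as ji =
     -k. *)
  have : f X (kk R *: W) = f X (- kk R *: W).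
    by rewrite -{1}ijk -scalerA !swap scalerA jik.
  move=> fkN; have := fDr X (kk R *: W) (- kk R *: W).
  rewrite scaleNr subrr -scaleNr -fkN -mulr2n.
  rewrite -(scale0r X) f0 => /esym/eqP.
  by rewrite mulrn_eq0 => /eqP.
(* Every [Y] is a multiple by k, namely of -kY. *)
rewrite -[Y]scale1r (_ : 1 = kk R * - kk R) -?scalerA ?fk //.
by apply: quat_eq => /=; ring.
Qed.

Lemma Gpoly_not_sos (R : realType) k : (2 <= k)%N -> ~ sos (Gpoly R k).
Proof.
move=> k_ge2 [s Gs].
have GE (x : HH R k) : G x = \sum_(q <- s) meval (flat x 0) q ^+ 2.
  have := meval_Gpoly (flat x); rewrite Gs raddf_sum /Gfun flatK => <-.
  by apply: eq_bigr => q _; rewrite /= rmorphXn.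
have zero (x : HH R k) q : q \in s -> G x = 0 -> meval (flat x 0) q = 0.
  move=> qs; rewrite GE => /eqP; rewrite psumr_eq0 => [|i _]; last exact: sqr_ge0.
  by move=> /allP /(_ q qs); rewrite sqrf_eq0 => /eqP.
(* The quadratic hypothesis is met below by directions [z] with one component zero. *)
have affine (x z : HH R k) q :
    (exists bc : R * R, forall t,
       G (x.1 + Quat t 0 0 0 *: z.1, x.2 + Quat t 0 0 0 *: z.2) =
       G x + t * bc.1 + t ^+ 2 * bc.2) ->
    q \in s ->
    exists e : R * R, forall t,
      meval (flat (x.1 + Quat t 0 0 0 *: z.1, x.2 + Quat t 0 0 0 *: z.2) 0) q
      = e.1 + t * e.2.
  move=> [bc quad] qs.
  have [t|e eE] := @sos_affine_line R _ s (flat x) (flat z)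
    (G x) bc.1 bc.2 _ q qs.
    by rewrite -flat_line -GE quad.
  by exists e => t; rewrite flat_line eE.
have G0r (X : 'rV[quat R]_k) : G (X, 0) = 0.
  by rewrite -(scale0r X) G_collinear.
have null q (X Y : 'rV[quat R]_k) : q \in s -> meval (flat (X, Y) 0) q = 0.
  move=> qs; pose f (X Y : 'rV[quat R]_k) := meval (flat (X, Y) 0) q.
  apply: (@biadditive_eq0 R k f) => [{}X|{}Y|p {}X].
  - apply: affine_additive => [|{}Y Z]; first exact: zero (G0r X).
    have [|e eE] := affine (X, Y) (0, Z) q _ qs.
      by eexists (_, _) => t; rewrite /= scaler0 addr0; exact: G_liner.
    by exists e => t; have := eE t; rewrite /= scaler0 addr0.
  - apply: affine_additive => [|{}X Z]; first by apply: zero; rewrite // G_sym.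
    have [|e eE] := affine (X, Y) (Z, 0) q _ qs.
      eexists (_, _) => t; rewrite /= scaler0 addr0 !(G_sym _ Y).
      exact: G_liner.
    by exists e => t; have := eE t; rewrite /= scaler0 addr0.
  - exact: zero (G_collinear _ _).
(* As k is at least 2, two distinct basis vectors exist; they are orthonormal, so [G] is 1 there,
   whereas [null] kills every square of the sum. *)
pose e (j : nat) : 'rV[quat R]_k := \row_i (i == j :> nat)%:R.
have norm_e j : (j < k)%N -> normH2 (e j) = 1.
  move=> ltj; rewrite /normH2 (bigD1 (Ordinal ltj)) //= big1 => [|i]; rewrite !mxE.
    by rewrite eqxx /normq2 /= expr1n !expr0n !addr0.
  by rewrite -val_eqE => /negPf -> /=; rewrite /normq2 /= !expr0n !addr0.
have dot_e : dotH (e 0%N) (e 1%N) = 0.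
  rewrite /dotH big1 // => i _; rewrite !mxE.
  by case: (val i) => [|[|?]]; rewrite /= ?mul0r // conjq0 mulr0.
have := GE (e 0%N, e 1%N); rewrite big_seq big1 => [|q qs];
  last by rewrite null ?expr0n.
rewrite /G /= !norm_e ?(ltnW k_ge2) // dot_e /normq2 /=.
rewrite !expr0n !addr0 mul1r subr0.
by move/eqP; rewrite oner_eq0.
Qed.

Theorem proposition6p1 (R : realType) (k : nat) (k_ge2 : (2 <= k)%N) :
  [/\ psd (Gpoly R k) /\ ~ sos (Gpoly R k),
      sos (sqnorm_poly R k * Gpoly R k) /\
      (forall X Y : 'rV[quat R]_k,
         4 * (normH2 X + normH2 Y) * G (X, Y)
         = norm2 (grad (@Gfun R k) (flat (X, Y))))
    & forall X Y : 'rV[quat R]_k,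
        let x : HH R k := (X, Y) in
        4 * (\sum_(alpha < 5) dot (flat (P alpha x)) (flat x) ^+ 2)
          * (normH2 X * normH2 Y - normq2 (dotH X Y))
        = normL2 (wedge
            (\sum_(alpha < 5)
               dot (flat (P alpha x)) (flat x) *: flat (P alpha x))
            (flat x))].
Proof.
split=> [||X Y x].
- split; last exact: Gpoly_not_sos.
  move=> v; have <- : (\row_i v i : 'rV[R]_(k * 4 + k * 4)) 0 = v.
    by apply/funext => i; rewrite mxE.
  by rewrite meval_Gpoly G_ge0.
- split; first exact: sos_sqnorm_Gpoly.
  by move=> X Y; rewrite norm2_grad_Gfun /Gfun flatK norm2_flat.
suff: 4 * (\sum_(alpha < 5) Pform alpha x ^+ 2) * G x
      = normL2 (wedge (Pfield x) (flat x)) by [].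
(* With N = |x|^2 and S the sum of the squared forms, the right side is (NS)N - S^2 = S(N^2 - S) =
   4SG. *)
by rewrite normL2_wedge norm2_Pfield dot_Pfield sum_Pform2; ring.
Qed.
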